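(* Let $p>1$ and $f(u)=|u|^{p-1}u$. Then the problem $$\begin{cases} u_{tt}-u_{xx}=f(u),\\ {u}(t+2\pi,x)=u(t,x+2\pi)=u(t,x) \end{cases}$$ for $u=u(t,x)$, $(t,x)\in\mathbb{R}\times\mathbb{R}$, has an infinite sequence of solutions.
   Context: Solutions are real-valued functions on $S^1\times S^1$ with $S^1=\mathbb{R}/2\pi\mathbb{Z}$ (i.e. $2\pi$-periodic in both time and space), understood in the weak sense. *)

(* Defs.v *)
From HB Require Import structures.
From mathcomp Require Import all_boot all_order all_algebra.
From mathcomp Require Import all_classical all_reals all_analysis.
Set Implicit Arguments.
Unset Strict Implicit.
Unset Printing Implicit Defensive.
Import Order.TTheory GRing.Theory Num.Theory.
Import numFieldNormedType.Exports.
Local Open Scope classical_set_scope.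
Local Open Scope ring_scope.

(* Points of the plane are pairs z = (t, x), time first. *)

Notation leb2 R := (@lebesgue_measure R \x @lebesgue_measure R)%E.

(* A fundamental domain of the torus (R / 2 pi Z)^2; functions on the torus
   are represented by doubly 2 pi-periodic functions on the plane. *)
Definition period_square (R : realType) : set (R * R) :=
  `[0, 2 * pi] `*` `[0, 2 * pi].

Definition doubly_periodic (R : realType) (u : R * R -> R) : Prop :=
  forall t x : R, u (t + 2 * pi, x) = u (t, x) /\ u (t, x + 2 * pi) = u (t, x).

(* C^infty: all iterated directional derivatives exist and are continuous. *)
Definition smooth (R : realType) (phi : R * R -> R) : Prop :=
  forall vs : seq (R * R),
    let psi := foldr (fun v (g : R * R -> R) => 'D_v g) phi vs in
    continuous psi /\ forall z v : R * R, derivable psi z v.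

(* phi_tt - phi_xx *)
Definition wave_op (R : realType) (phi : R * R -> R) : R * R -> R :=
  'D_(1, 0) ('D_(1, 0) phi) \- 'D_(0, 1) ('D_(0, 1) phi).

Definition power_nonlinearity (R : realType) (p s : R) : R :=
  `|s| `^ (p - 1) * s.

(* Weak solutions on the torus, in the space L^(p+1) on which the associated
   action functional has a finite potential term.  Since p > 1 and the period
   square has finite measure, u and |u|^(p-1) u are then integrable there, so
   both integrals below are genuine. *)
Definition weak_solution (R : realType) (p : R) (u : R * R -> R) : Prop :=
  [/\ measurable_fun [set: measurableTypeR R * measurableTypeR R] u,
      doubly_periodic u,
      (leb2 R).-integrable (@period_square R)
        (fun z => (`|u z| `^ (p + 1))%:E)
    & forall phi : R * R -> R, smooth phi -> doubly_periodic phi ->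
        \int[leb2 R]_(z in @period_square R) (u z * wave_op phi z) =
        \int[leb2 R]_(z in @period_square R)
          (power_nonlinearity p (u z) * phi z)].

(* Main.v *)
Require Import Defs.
From mathcomp Require Import all_boot all_order all_algebra.
From mathcomp Require Import all_classical all_reals all_analysis.
From mathcomp Require Import measurable_realfun.
From mathcomp Require Import ring lra.
Import Order.TTheory GRing.Theory Num.Theory.
Import numFieldNormedType.Exports.
Local Open Scope classical_set_scope.
Local Open Scope ring_scope.

(** Solutions that do not depend on time suffice: the equation becomes
    [- V'' = |V|^(p-1) V], the equation of a particle in the even convex
    potential [|V|^(p+1) / (p+1)], all of whose nonzero orbits are periodic.

    One such orbit is obtained by quadrature ([anharmonic_oscillator]).  The
    substitution [v = sin y] removes the turning-point singularity of the
    energy equation and leaves a scalar equation [y' = G(y)] with [G]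
    continuous, positive and [2 pi]-periodic ([squared_angular_speed]), which
    is solved by inverting an antiderivative of [1 / G] ([autonomous_ode]).
    By homogeneity of the nonlinearity, amplitude and frequency of the
    orbit can be rescaled together so that the [n]-th profile has period
    [2 pi / (n+1)]; the amplitudes are then pairwise distinct
    ([periodic_profiles]).

    A [C^2] periodic profile is a weak solution by Fubini and the fundamental
    theorem of calculus in each variable ([stationary_weak_solution]), and
    profiles with different maxima differ on a set of positive measure
    ([continuous_not_ae_eq]). *)

(** * Derivatives of real functions and the power nonlinearity *)

Lemma is_derive_continuous (R : realType) (f : R -> R) (x a : R) :
  is_derive x 1 f a -> {for x, continuous f}.
Proof.
by move=> df; apply/differentiable_continuous/derivable1_diffP; case: df.
Qed.

Lemma is_derive_mul (R : realType) (f g : R -> R) (x a b : R) :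
  is_derive x 1 f a -> is_derive x 1 g b ->
  is_derive x 1 (fun y => f y * g y) (a * g x + f x * b).
Proof.
move=> fa gb; have := is_deriveM fa gb.
by move/is_derive_eq; apply; rewrite /GRing.scale/= addrC mulrC.
Qed.

Lemma is_derive_scale (R : realType) (f : R -> R) (k x a : R) :
  is_derive x 1 f a -> is_derive x 1 (fun y => k * f y) (k * a).
Proof. by move=> fa; have := is_deriveZ k fa. Qed.

(** At a zero of [f] the product rule needs only continuity of [g].  This
    handles the two kinds of degenerate points below: the zeros of
    [|s|^(p+1)] and the turning points of the oscillation. *)
Lemma is_derive_vanishing_mul (R : realType) (f g : R -> R) (x a : R) :
  is_derive x 1 f a -> f x = 0 -> {for x, continuous g} ->
  is_derive x 1 (fun y => f y * g y) (a * g x).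
Proof.
move=> /is_derive1_caratheodory[h [fE hx <-]] fx0 gx.
apply/is_derive1_caratheodory; exists (fun y => h y * g y); split => //.
- move=> z; rewrite fx0 mul0r subr0 mulrAC -fE fx0 subr0//.
- exact: continuousM.
Qed.

Lemma continuous_powR_norm (R : realType) (r : R) : 0 < r ->
  continuous (fun s : R => `|s| `^ r).
Proof.
move=> r0 s; have [->|s0] := eqVneq s 0.
  apply/cvgrPdist_lt => e e0.
  near=> x.
  rewrite normr0 powR0 ?gt_eqF// sub0r normrN ger0_norm ?powR_ge0//.
  rewrite -[ltRHS](@powRr1 _ e) ?ltW// -(@mulVf _ r) ?gt_eqF// powRrM.
  apply: gt0_ltr_powR; rewrite ?nnegrE ?powR_ge0//.
  near: x.
  exists (e `^ r^-1); first exact: powR_gt0.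
  by move=> y /=; rewrite sub0r normrN.
have s1 : 0 < `|s| by rewrite normr_gt0.
apply: (@continuous_comp _ _ _ (fun s : R => `|s|) (fun y : R => y `^ r)).
  exact: norm_continuous.
exact/is_derive_continuous/is_derive1_powR.
Unshelve. all: by end_near. Qed.

Lemma continuous_power_nonlinearity (R : realType) (p : R) : 1 < p ->
  continuous (power_nonlinearity p).
Proof.
move=> p1 s.
apply: (@continuousM _ _ (fun s : R => `|s| `^ (p - 1)) id s); last exact: cvg_id.
by apply: continuous_powR_norm; rewrite subr_gt0.
Qed.

Lemma powR_norm_power_nonlinearity (R : realType) (p s : R) : 1 < p ->
  `|s| `^ (p + 1) = s * power_nonlinearity p s.
Proof.
move=> p1; rewrite /power_nonlinearity mulrCA -expr2 -real_normK ?num_real//.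
have -> : p + 1 = (p - 1) + 2%:R by rewrite -natr1; ring.
rewrite powRD ?powR_mulrn//; apply/implyP => /eqP; lra.
Qed.

(** At the origin [|s|^(p+1)] is [s] times the continuous function
    [|s|^(p-1) s]; elsewhere [|s| = e s] with [e] a locally constant sign. *)
Lemma is_derive_powR_norm (R : realType) (p s : R) : 1 < p ->
  is_derive s 1 (fun x : R => `|x| `^ (p + 1))
    ((p + 1) * power_nonlinearity p s).
Proof.
move=> p1.
have [->|s0] := eqVneq s 0.
  have -> : (fun x : R => `|x| `^ (p + 1)) =
            (fun x : R => x * power_nonlinearity p x).
    by apply/funext => x; exact: powR_norm_power_nonlinearity.
  have := @is_derive_vanishing_mul R id (power_nonlinearity p) 0 1 _ erefl
    (continuous_power_nonlinearity _ p p1 0).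
  by rewrite {2 4}/power_nonlinearity !mulr0; apply; exact: is_derive_id.
(* The sign e of s is kept as a parameter, to treat both half-lines at once. *)
have pw (e : R) : 0 < e * s ->
    is_derive s 1 (fun x : R => (e * x) `^ (p + 1))
      (((p + 1) * (e * s) `^ p) * e).
  move=> es.
  apply: (@is_derive1_comp _ (fun y : R => y `^ (p + 1)) (fun x => e * x)).
    by have := is_derive1_powR (p + 1) es; rewrite addrK.
  by have := is_derive_scale _ _ e _ _ (@is_derive_id _ R s 1); rewrite mulr1.
have key (e : R) : 0 < e * s -> (e = 1 \/ e = -1) ->
  is_derive s 1 (fun x : R => `|x| `^ (p + 1))
    ((p + 1) * power_nonlinearity p s).
  move=> es e1.
  have ne (x : R) : 0 <= e * x -> `|x| = e * x.
    move=> ex; rewrite -(ger0_norm ex) normrM.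
    by case: e1 => ->; rewrite ?normrN normr1 mul1r.
  apply: (near_eq_is_derive (f := fun x : R => (e * x) `^ (p + 1))).
    near=> x; congr (_ `^ _); apply/esym/ne.
    apply: ltW; near: x.
    apply: (@cvgr_gt _ _ _ _ (fun x : R => e * x) (e * s)); last exact: es.
    by apply: cvgM; [exact: cvg_cst|exact: cvg_id].
  apply: is_derive_eq; first exact: (pw _ es).
  rewrite /power_nonlinearity ne ?ltW//.
  rewrite -[in LHS](@mulr_powRB1 _ (e * s) p) ?(ltW es)//; last lra.
  have ee : e * e = 1 by case: e1 => ->; ring.
  set z := (_ `^ _).
  by transitivity ((p + 1) * (z * s) * (e * e)); [ring|rewrite ee mulr1].
have [sp|sn|/eqP] := ltgtP s 0; last by rewrite (negbTE s0).
- by apply: (key (-1)); [rewrite mulN1r oppr_gt0|right].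
- by apply: (key 1); [rewrite mul1r|left].
Unshelve. all: by end_near. Qed.

(** * Quadrature of the oscillator *)

(** Writing [v = sin y] turns the energy identity
    [v'^2 = 2/(p+1) (1 - |v|^(p+1))] into [y'^2 = S(y)], where [S] is the
    quotient of [2/(p+1) (1 - |sin y|^(p+1))] by [cos^2 y].  As a function of
    [sigma = sin^2 y], this is [2/(p+1)] times the difference quotient of
    [sigma^((p+1)/2)] at [sigma = 1], hence the singularity at the turning
    points [cos y = 0] is removable and [S] takes there the value [1]. *)
Lemma squared_angular_speed (R : realType) (p : R) (hp : 1 < p) :
  exists S : R -> R,
    [/\ continuous S, forall y, 0 < S y, forall y, S (y + 2 * pi) = S y,
        forall y, cos y = 0 -> S y = 1
      & forall y, cos y ^+ 2 * S y = 2 / (p + 1) * (1 - `|sin y| `^ (p + 1))].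
Proof.
have p1 : 0 < p + 1 by lra.
pose q2 := (p + 1) / 2.
(* h is the difference quotient of sigma^q2 at 1, extended by q2 at 1. *)
have /is_derive1_caratheodory[h [hE hc h1]] : is_derive (1 : R) 1 (fun y : R => y `^ q2) q2.
  by have := is_derive1_powR q2 (@ltr01 R); rewrite powR1 mulr1.
have sinE (y : R) : (sin y ^+ 2) `^ q2 = `|sin y| `^ (p + 1).
  rewrite -real_normK ?num_real// -powR_mulrn// -powRrM /q2.
  by congr (_ `^ _); rewrite mulrC divfK.
have cosE (y : R) : sin y ^+ 2 - 1 = - (cos y ^+ 2).
  by rewrite -(cos2Dsin2 y); ring.
pose S (y : R) := 2 / (p + 1) * h (sin y ^+ 2).
have SE y : cos y ^+ 2 * S y = 2 / (p + 1) * (1 - `|sin y| `^ (p + 1)).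
  have := hE (sin y ^+ 2); rewrite sinE powR1 cosE => e.
  have -> : 1 - `|sin y| `^ (p + 1) = - (`|sin y| `^ (p + 1) - 1) by ring.
  by rewrite e /S; ring.
have S1 y : cos y = 0 -> S y = 1.
  move=> y0; rewrite /S sin2cos2 y0 expr0n subr0 h1 /q2.
  by field; rewrite gt_eqF.
have SEn y : cos y != 0 ->
    S y = (2 / (p + 1) * (1 - `|sin y| `^ (p + 1))) * (cos y ^+ 2)^-1.
  by move=> y0; rewrite -SE mulrAC mulfV ?mul1r// expf_neq0.
exists S; split => //.
- move=> y; have [y0|y0] := eqVneq (cos y) 0.
    apply: cvgM; first exact: cvg_cst.
    apply: (@continuous_comp _ _ _ (fun y : R => sin y ^+ 2) h).
      apply: (@continuous_comp _ _ _ (@sin R) (fun s => s ^+ 2)).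
        exact: continuous_sin.
      exact: exprn_continuous.
    by rewrite /= sin2cos2 y0 expr0n subr0.
  apply: cvg_trans (_ : (fun y =>
     (2 / (p + 1) * (1 - `|sin y| `^ (p + 1))) * (cos y ^+ 2)^-1) x
       @[x --> y] --> S y).
    apply: near_eq_cvg; near=> x; apply/esym/SEn.
    by near: x; apply: (@cvgr_neq0 _ _ _ _ _ _ (cos y)) => //; exact: continuous_cos.
  rewrite SEn//; apply: cvgM.
    apply: cvgM; first exact: cvg_cst.
    apply: cvgB; first exact: cvg_cst.
    apply: (@continuous_comp _ _ _ (fun y : R => sin y) (fun s => `|s| `^ (p + 1))).
      exact: continuous_sin.
    exact: continuous_powR_norm.
  apply: cvgV; first by rewrite expf_neq0.
  apply: (@continuous_comp _ _ _ (@cos R) (fun s => s ^+ 2)).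
    exact: continuous_cos.
  exact: exprn_continuous.
- move=> y; have [y0|y0] := eqVneq (cos y) 0; first by rewrite S1.
  have c2 : 0 < cos y ^+ 2 by rewrite exprn_even_gt0.
  rewrite SEn// mulr_gt0 ?invr_gt0// mulr_gt0 ?divr_gt0// subr_gt0.
  have s1 : `|sin y| < 1.
    rewrite -(@ltr_pXn2r _ 2)// ?nnegrE// expr1n real_normK ?num_real//.
    by rewrite sin2cos2 gtrBl.
  have e1 : 1 = 1 `^ (p + 1) :> R by rewrite powR1.
  by rewrite [ltRHS]e1; apply: gt0_ltr_powR; rewrite ?nnegrE.
- by move=> y; rewrite /S (mulr_natl pi 2) sinD2pi.
Unshelve. all: by end_near. Qed.

(** Integrals from a base point [a] are differentiable only to the right of
    [a].  The base point is therefore moved with [x], staying to the left of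
    both [x] and [0]; the increment from [0] does not depend on it. *)
Lemma continuous_antiderivative (R : realType) (g : R -> R) :
  continuous g -> exists X : R -> R, forall x : R, is_derive x 1 X (g x).
Proof.
move=> gc.
have gi a b : (@lebesgue_measure R).-integrable `[a, b] (EFin \o g).
  apply: continuous_compact_integrable; first exact: segment_compact.
  exact: continuous_subspaceT.
pose P a x := \int[@lebesgue_measure R]_(t in `[a, x]) g t.
have PB a b x : b <= a -> a <= x -> P b x - P b a = P a x.
  move=> ba ax; rewrite /P Rintegral_itvB ?bnd_simp//.
  rewrite Rintegral_itv_obnd_cbnd//.
  apply: integrableS (gi a x) => //.
  by apply: subset_itvr; rewrite bnd_simp.
have Pa a b x : b <= a -> a <= 0 -> a <= x -> P b x - P b 0 = P a x - P a 0.
  by move=> ba a0 ax; rewrite -(PB a b x)// -(PB a b 0)//; ring.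
have min1 (x : R) : Num.min x 0 <= x by rewrite ge_min lexx.
have min2 (x : R) : Num.min x 0 <= 0 by rewrite ge_min lexx orbT.
exists (fun x => P (Num.min x 0 - 1) x - P (Num.min x 0 - 1) 0) => x.
pose a := Num.min x 0 - 2.
have a0 : a < 0 by rewrite /a; have := min2 x; lra.
have ax : a < x by rewrite /a; have := min1 x; lra.
apply: (near_eq_is_derive (f := fun x => P a x - P a 0)).
  near=> y.
  have xy : `|x - y| < 1.
    by near: y; apply: cvgr_dist_lt => //; exact: cvg_id.
  have mxy : Num.min x 0 - 1 <= Num.min y 0.
    rewrite le_min !lerBlDr !ge_min; move: xy; rewrite ltr_norml => /andP[_ xy].
    by apply/andP; split; apply/orP; [left|right]; lra.
  apply: Pa.
  - by rewrite /a; lra.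
  - by have := min2 y; lra.
  - by have := min1 y; lra.
have x1 : x < x + 1 by rewrite ltrDl.
have [dP P'] := continuous_FTC1_closed x1 (gi _ _) ax (gc x).
have PD : is_derive x 1 (P a) (g x) by split; [exact: dP|rewrite -P' derive1E].
have := is_deriveB PD (is_derive_cst (P a 0) x 1).
by rewrite subr0.
Unshelve. all: by end_near. Qed.

(** Separation of variables: an antiderivative [X] of [1 / G] gives the time
    at which each position is reached.  It is strictly increasing, and it
    increases by a constant [T] over each period of [G], hence it is onto; the
    solution is its inverse. *)
Lemma autonomous_ode (R : realType) (G : R -> R) (a : R) :
  continuous G -> (forall y, 0 < G y) -> 0 < a ->
  (forall y, G (y + a) = G y) ->
  exists (y : R -> R) (T : R),
    [/\ 0 < T, forall x : R, is_derive x 1 y (G (y x)),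
        forall x, y (x + T) = y x + a & forall z, exists x, y x = z].
Proof.
move=> Gc G0 a0 Ga.
have Gn0 y : G y != 0 by rewrite gt_eqF.
have [X dX] : exists X : R -> R, forall x : R, is_derive x 1 X (G x)^-1.
  by apply: continuous_antiderivative => x; apply: cvgV => //; exact: Gc.
have Xc : continuous X by move=> x; exact: is_derive_continuous.
have Xlt x y : x < y -> X x < X y.
  move=> xy; have [|c _] := MVT xy (fun x _ => dX x).
    exact: continuous_subspaceT.
  by move=> e; rewrite -subr_gt0 e mulr_gt0 ?invr_gt0// subr_gt0.
have Xinj : injective X.
  by move=> x y e; case: (ltgtP x y) => // /Xlt; rewrite e ltxx.
pose T := X a - X 0.
have T0 : 0 < T by rewrite subr_gt0; exact: Xlt.
have XT y : X (y + a) = X y + T.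
  suff : X (y + a) - X y = T by move=> <-; ring.
  have -> : T = X (0 + a) - X 0 by rewrite add0r.
  apply: (@is_derive_0_is_cst _ (fun y => X (y + a) - X y)) => x.
  have dXa : is_derive x 1 (fun x => X (x + a)) (G x)^-1.
    rewrite -Ga -[_^-1]mulr1; apply: is_derive1_comp.
    by have := is_deriveD (is_derive_id x (1 : R)) (is_derive_cst a x 1); rewrite addr0.
  by have := is_deriveB dXa (dX x); rewrite subrr.
clearbody T.
have XnT n y : X (y + n%:R * a) = X y + n%:R * T.
  elim: n => [|n IH]; first by rewrite !mul0r !addr0.
  by rewrite -natr1 !mulrDl !mul1r !addrA XT IH.
have Xsurj z : exists x, X x = z.
  have [n nz] : exists n : nat, `|z - X 0| <= n%:R * T.
    exists (Num.bound (`|z - X 0| / T)).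
    rewrite -ler_pdivrMr//; apply/ltW.
    by apply: archi_boundP; rewrite divr_ge0// ltW.
  move: nz; rewrite ler_norml => /andP[nz1 nz2].
  have na : 0 <= n%:R * a by rewrite mulr_ge0// ltW.
  have e1 := XnT n 0; have e2 := XnT n (- (n%:R * a)).
  rewrite add0r in e1; rewrite addNr in e2.
  have [|||x _ xz] := @IVT _ X (- (n%:R * a)) (n%:R * a) z; last by exists x.
  - by lra.
  - exact: continuous_subspaceT.
  - by apply/andP; split; rewrite ?ge_min ?le_max; apply/orP; [left|right]; lra.
have [y Xy] := choice Xsurj.
have yX : cancel X y by move=> x; apply: Xinj; rewrite Xy.
exists y, T; split => //.
- move=> x; rewrite -{1}(Xy x) -[G _]invrK.
  apply: is_derive_inverse; [| |by rewrite invr_eq0].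
    by near=> t; exact: yX.
  by near=> t; exact: Xc.
- by move=> x; apply: Xinj; rewrite XT !Xy.
- by move=> z; exists (X z).
Unshelve. all: by end_near. Qed.

(** From [w(z)^2 - w(x)^2 = (w(z) + w(x)) (w(z) - w(x))]: the first factor
    is nonzero near [x], so the difference quotients of [w^2] control those
    of [w]. *)
Lemma is_derive_of_sqr (R : realType) (w : R -> R) (x a : R) :
  {for x, continuous w} -> w x != 0 ->
  is_derive x 1 (fun y : R => w y ^+ 2) (2 * w x * a) -> is_derive x 1 w a.
Proof.
move=> wc wx0 /is_derive1_caratheodory[h [hE hc hx]].
have wwx : w x + w x != 0 by rewrite -mulr2n mulrn_eq0.
(* The first branch only makes the factorization exact at the points, all
   away from x, where w(z) = - w(x). *)
pose g z := if w z + w x == 0 then (w z - w x) / (z - x) else h z / (w z + w x).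
apply/is_derive1_caratheodory; exists g; split.
- move=> z; rewrite /g; case: ifPn => wz.
    by rewrite divfK// subr_eq0; apply: contraNneq wwx => zx; rewrite -{1}zx.
  by rewrite mulrAC -hE subr_sqr mulfK.
- have -> : {for x, continuous g} = (g z @[z --> x] --> h x / (w x + w x)).
    by rewrite /prop_for /continuous_at /g (negbTE wwx).
  apply: cvg_trans (_ : (h z / (w z + w x)) @[z --> x] --> h x / (w x + w x)).
    apply: near_eq_cvg; near=> z; rewrite /g ifN//.
    near: z; apply: (@cvgr_neq0 _ _ _ _ _ _ (w x + w x)) => //.
    by apply: cvgD; [exact: wc|exact: cvg_cst].
  apply: cvgM; first exact: hc.
  by apply: cvgV => //; apply: cvgD; [exact: wc|exact: cvg_cst].
- rewrite /g (negbTE wwx) hx; field.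
  exact: wwx.
Unshelve. all: by end_near. Qed.

(** The oscillation [v = sin y], [w = v'] with [y' = sqrt(S(y))].  Away from
    the turning points, differentiating the energy identity
    [w^2 = 2/(p+1) (1 - |v|^(p+1))] and dividing by [2 w] gives
    [w' = - |v|^(p-1) v].  At a turning point, [w = cos y * sqrt(S(y))] has a
    vanishing differentiable factor and a factor equal to [1], whence
    [w' = - sin y = - v], and [|v| = 1]. *)
Lemma anharmonic_oscillator (R : realType) (p : R) : 1 < p ->
  exists (v w : R -> R) (T : R),
    [/\ 0 < T, forall x : R, is_derive x 1 v (w x),
        forall x : R, is_derive x 1 w (- power_nonlinearity p (v x)),
        forall x, v (x + T) = v x /\ w (x + T) = w x
      & (forall x, `|v x| <= 1) /\ exists x, v x = 1].
Proof.
move=> p1.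
have [S [Sc S0 Sper Scos SE]] := squared_angular_speed _ _ p1.
pose G y := Num.sqrt (S y).
have Gc : continuous G.
  by move=> y; apply: continuous_comp; [exact: Sc|exact: sqrt_continuous].
have G0 y : 0 < G y by rewrite sqrtr_gt0.
have [||y [T [T0 dy yT ysurj]]] := autonomous_ode _ _ (2 * pi) Gc G0.
- by rewrite mulr_gt0// pi_gt0.
- by move=> z; rewrite /G Sper.
have dv (x : R) : is_derive x 1 (fun x => sin (y x)) (cos (y x) * G (y x)).
  exact: (@is_derive1_comp _ (@sin R) y).
pose v x := sin (y x); pose w x := cos (y x) * G (y x).
have yc : continuous y by move=> x; exact: is_derive_continuous.
have Gyc : continuous (fun x => G (y x)).
  by move=> x; apply: continuous_comp; [exact: yc|exact: Gc].
have w2 : (fun x => w x ^+ 2) =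
          (fun x => 2 / (p + 1) * (1 - `|v x| `^ (p + 1))).
  by apply/funext => x; rewrite /w exprMn sqr_sqrtr ?SE// ltW.
have wc : continuous w.
  move=> x; apply: cvgM; last exact: Gyc.
  by apply: (@continuous_comp _ _ _ y (@cos R)); [exact: yc|exact: continuous_cos].
have dw2 (x : R) : is_derive x 1 (fun x => w x ^+ 2)
    (2 * w x * - power_nonlinearity p (v x)).
  rewrite w2.
  have dpow := @is_derive1_comp _ _ v x _ _ (is_derive_powR_norm _ _ (v x) p1) (dv x).
  have := is_derive_scale _ _ (2 / (p + 1)) _ _
    (is_deriveB (is_derive_cst (1 : R) x (1 : R)) dpow).
  move/is_derive_eq; apply; rewrite -/(w x); field.
  by rewrite gt_eqF//; lra.
exists v, w, T; split => //.
- move=> x; have [y0|y0] := eqVneq (cos (y x)) 0; last first.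
    apply: is_derive_of_sqr; [exact: wc|by apply: mulf_neq0; last by rewrite gt_eqF].
  have dcos : is_derive x 1 (fun x => cos (y x)) (- sin (y x) * G (y x)).
    exact: (@is_derive1_comp _ (@cos R) y).
  have := is_derive_vanishing_mul _ _ _ _ _ dcos y0 (Gyc x).
  move/is_derive_eq; apply.
  rewrite /G Scos// sqrtr1 !mulr1 /power_nonlinearity /v.
  have -> : `|sin (y x)| = 1.
    apply/eqP; rewrite -(@eqrXn2 _ 2)// real_normK ?num_real//.
    by rewrite sin2cos2 y0 expr0n subr0 expr1n.
  by rewrite powR1 mul1r.
- by move=> x; rewrite /v /w yT /G Sper (mulr_natl pi 2) sinD2pi cosD2pi.
- split; last by have [x yx] := ysurj (pi / 2); exists x; rewrite /v yx sin_pihalf.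
  by move=> x; rewrite ler_norml sin_geN1 sin_le1.
Qed.


(** The equation is invariant under [v -> k^(2/(p-1)) v(k x)].  Choosing [k]
    so that [2 pi] is [n+1] periods of the rescaled oscillation gives
    profiles with pairwise distinct maxima [a n]. *)
Lemma periodic_profiles (R : realType) (p : R) : 1 < p ->
  exists (V W : nat -> R -> R) (a : nat -> R), injective a /\ forall n,
    [/\ forall x : R, is_derive x 1 (V n) (W n x),
        forall x : R, is_derive x 1 (W n) (- power_nonlinearity p (V n x)),
        forall x, V n (x + 2 * pi) = V n x /\ W n (x + 2 * pi) = W n x
      & (forall x, V n x <= a n) /\ exists x, V n x = a n].
Proof.
move=> p1; have [v [w [T [T0 dv dw per [vle [x1 vx1]]]]]] := anharmonic_oscillator _ _ p1.
have pi2 : 0 < 2 * pi :> R by rewrite mulr_gt0// pi_gt0.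
pose k (n : nat) : R := n.+1%:R * T / (2 * pi).
have k0 n : 0 < k n by rewrite divr_gt0// mulr_gt0.
pose a n := k n `^ (2 / (p - 1)).
have a0 n : 0 < a n by rewrite powR_gt0.
have pm1 : 0 < p - 1 by lra.
have ak n : a n `^ (p - 1) = k n ^+ 2.
  by rewrite /a -powRrM divfK ?gt_eqF// powR_mulrn// ltW.
have perN n x : v (x + n%:R * T) = v x /\ w (x + n%:R * T) = w x.
  have perv y := (per y).1; have perw y := (per y).2.
  elim: n => [|n [IHv IHw]]; first by rewrite mul0r addr0.
  by rewrite -natr1 mulrDl mul1r addrA perv perw IHv IHw.
have dk n (f : R -> R) (b x : R) : is_derive (k n * x) 1 f b ->
    is_derive x 1 (fun y => f (k n * y)) (b * k n).
  move=> df; apply: is_derive1_comp.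
  by have := is_derive_scale _ _ (k n) _ _ (is_derive_id x (1 : R)); rewrite mulr1.
exists (fun n x => a n * v (k n * x)), (fun n x => a n * (w (k n * x) * k n)), a.
split=> [m n|n].
  move=> amn; have kmn : k m = k n.
    apply: (@powR_injective _ (2 / (p - 1))) amn; first exact: divr_gt0.
    - by rewrite nnegrE ltW.
    - by rewrite nnegrE ltW.
  have nm : m.+1%:R = n.+1%:R :> R.
    apply: (mulIf (lt0r_neq0 T0)); apply: (mulIf (x := (2 * pi)^-1)); last exact: kmn.
    by rewrite invr_eq0 gt_eqF.
  by move/eqP : nm; rewrite eqr_nat => /eqP[].
split.
- by move=> x; apply: is_derive_scale; exact: dk.
- move=> x.
  have dwk := dk n w _ x (dw (k n * x)).
  have := is_derive_scale _ _ (a n * k n) _ _ dwk.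
  have -> : (fun y => a n * k n * w (k n * y)) =
            (fun y => a n * (w (k n * y) * k n)).
    by apply/funext => y; ring.
  move/is_derive_eq; apply.
  rewrite /power_nonlinearity normrM powRM// gtr0_norm// ak.
  ring.
- move=> x.
  have -> : k n * (x + 2 * pi) = k n * x + n.+1%:R * T.
    by rewrite mulrDr /k divfK ?gt_eqF.
  by rewrite (perN _ _).1 (perN _ _).2.
- split; last by exists (x1 / k n); rewrite mulrC (mulrC (k n)) divfK ?gt_eqF// vx1 mul1r.
  move=> x; rewrite -[leRHS]mulr1 ler_wpM2l// ?(ltW (a0 n))//.
  exact: le_trans (ler_norm _) (vle _).
Qed.

(** * Integration over the period square *)

(** Measurability refers to the product sigma-algebra, so open sets of the
    plane are first exhausted by countably many rational rectangles. *)
Lemma continuous_measurable_plane (R : realType) (f : R * R -> R) :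
  continuous f ->
  measurable_fun [set: measurableTypeR R * measurableTypeR R] f.
Proof.
move=> fc.
have oM (U : set (R * R)) : open U ->
    measurable (U : set (measurableTypeR R * measurableTypeR R)).
  move=> oU.
  pose rect (q : (rat * rat) * (rat * rat)) : set (R * R) :=
    ball (ratr q.1.1 : R) (ratr q.1.2) `*` ball (ratr q.2.1 : R) (ratr q.2.2).
  have -> : U = \bigcup_q [set z | rect q `<=` U /\ rect q z].
    apply/seteqP; split => [[t x] Utx|z [q _ [qU qz]]]; last exact: qU.
    have [[A B] [/= nA nB] ABU] : nbhs (t, x) U by exact: open_nbhs_nbhs.
    have tA : t \in (interior A : set R) by rewrite inE.
    have xB : x \in (interior B : set R) by rewrite inE.
    have [c [r [/set_mem tcr crA]]] := open_subball_rat (open_interior A) tA.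
    have [d [s [/set_mem xds dsB]]] := open_subball_rat (open_interior B) xB.
    exists ((c, r), (d, s)) => //; split => // -[t' x'] [/= t'cr x'ds].
    by apply: ABU; split; apply: interior_subset; [exact: crA|exact: dsB].
  apply: countable_bigcupT_measurable; first exact: countableP.
  move=> q; have [qU|qU] := pselect (rect q `<=` U).
    rewrite (_ : [set z | _] = rect q); last by apply/seteqP; split => z // -[].
    by apply: measurableX; exact: measurable_ball.
  by rewrite (_ : [set z | _] = set0)//; apply/seteqP; split => z // -[].
apply: (measurability _ (RGenOpens.measurableE R)).
move=> _ [_ [a [b ->] <-]]; rewrite setTI; apply: oM.
by move/continuousP : fc; apply; exact: interval_open.
Qed.

Lemma leb2_rectangle (R : realType) (A B : set (measurableTypeR R)) :
  measurable A -> measurable B ->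
  leb2 R (A `*` B) = (@lebesgue_measure R A * @lebesgue_measure R B)%E.
Proof. by move=> mA mB; exact: product_measure1E. Qed.

Lemma compact_period_square (R : realType) : compact (@period_square R).
Proof. by apply: compact_setX; exact: segment_compact. Qed.

Lemma continuous_integrable_square (R : realType) (f : R * R -> R) :
  continuous f -> (leb2 R).-integrable (@period_square R) (EFin \o f).
Proof.
move=> fc; apply: measurable_bounded_integrable.
- exact: measurableX.
- change (leb2 R (@period_square R) < +oo)%E; rewrite /period_square.
  rewrite leb2_rectangle// !lebesgue_measure_itv/=.
  by case: ifPn => _; rewrite ?mule0 ?mul0e// -EFinD -EFinM ltry.
- exact: measurable_funTS (continuous_measurable_plane _ _ fc).
- have [M [Mr MP]] : bounded_set (f @` @period_square R).
    apply: compact_bounded; apply: continuous_compact; last exact: compact_period_square.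
    exact: continuous_subspaceT.
  by exists M; split => // y My z zS; apply: (MP y My); exists z.
Qed.

Lemma integral_total_derivative (R : realType) (F f : R -> R) :
  continuous f -> (forall x : R, is_derive x 1 F (f x)) ->
  F (0 + 2 * pi) = F 0 ->
  (\int[@lebesgue_measure R]_(x in `[0%R, (2 * pi)%R]) (f x)%:E = 0)%E.
Proof.
move=> fc dF per.
have Fc : continuous F by move=> x; exact: is_derive_continuous.
rewrite (@continuous_FTC2 _ f F).
- by rewrite -per add0r -EFinB subrr.
- by rewrite mulr_gt0// pi_gt0.
- exact: continuous_subspaceT.
- split; first by move=> x _; case: (dF x).
    by apply: cvg_at_right_filter; exact: Fc.
  by apply: cvg_at_left_filter; exact: Fc.
- by move=> x _; rewrite derive1E; case: (dF x).
Qed.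

Lemma mem_period_square (R : realType) (t x : R) :
  ((t, x) \in @period_square R) =
  (t \in `[0, 2 * pi]%classic) && (x \in `[0, 2 * pi]%classic).
Proof. by rewrite /period_square in_setX. Qed.

Lemma continuous_slices (R : realType) (g : R * R -> R) : continuous g ->
  (forall x, continuous (fun t => g (t, x))) /\
  (forall t, continuous (fun x => g (t, x))).
Proof.
move=> gc; split => a b.
  apply: (@continuous_comp _ _ _ (fun t : R => (t, a)) g); last exact: gc.
  exact: (cvg_pair (@cvg_id _ _) (@cvg_cst _ _ _ _ _)).
apply: (@continuous_comp _ _ _ (fun x : R => (a, x)) g); last exact: gc.
exact: (cvg_pair (@cvg_cst _ _ _ _ _) (@cvg_id _ _)).
Qed.

(** Fubini with the differentiated variable innermost: the inner integral is
    the increment of a periodic function over one period. *)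
Lemma integral_square_dt (R : realType) (g G : R * R -> R) :
  continuous g ->
  (forall t x : R, is_derive t 1 (fun s => G (s, x)) (g (t, x))) ->
  (forall t x, G (t + 2 * pi, x) = G (t, x)) ->
  \int[leb2 R]_(z in @period_square R) g z = 0.
Proof.
move=> gc dG per; rewrite /Rintegral.
rewrite integral_mkcond -integral21_prod_meas1; last first.
  rewrite -integrable_mkcond; last exact: measurableX.
  exact: continuous_integrable_square.
rewrite integral0_eq// => x _.
transitivity (\int[@lebesgue_measure R]_(t in `[0%R, (2 * pi)%R])
    (if x \in `[0%R, 2 * pi]%classic then g (t, x) else 0)%:E)%E.
  rewrite /fubini_G [RHS]integral_mkcond; apply: eq_integral => t _.
  by rewrite !patchE mem_period_square; case: (t \in _); case: (x \in _).
case: (_ \in _); last exact: integral0.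
apply: (integral_total_derivative _ (fun t => G (t, x)) (fun t => g (t, x))).
- exact: (continuous_slices _ _ gc).1.
- exact: per.
Qed.

Lemma integral_square_dx (R : realType) (g G : R * R -> R) :
  continuous g ->
  (forall t x : R, is_derive x 1 (fun y => G (t, y)) (g (t, x))) ->
  (forall t x, G (t, x + 2 * pi) = G (t, x)) ->
  \int[leb2 R]_(z in @period_square R) g z = 0.
Proof.
move=> gc dG per; rewrite /Rintegral.
rewrite integral_mkcond -integral12_prod_meas1; last first.
  rewrite -integrable_mkcond; last exact: measurableX.
  exact: continuous_integrable_square.
rewrite integral0_eq// => t _.
transitivity (\int[@lebesgue_measure R]_(x in `[0%R, (2 * pi)%R])
    (if t \in `[0%R, 2 * pi]%classic then g (t, x) else 0)%:E)%E.
  rewrite /fubini_F [RHS]integral_mkcond; apply: eq_integral => x _.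
  by rewrite !patchE mem_period_square; case: (t \in _); case: (x \in _).
case: (_ \in _); last exact: integral0.
apply: (integral_total_derivative _ (fun x => G (t, x)) (fun x => g (t, x))).
- exact: (continuous_slices _ _ gc).2.
- exact: per.
Qed.

(** * Stationary weak solutions *)

Lemma is_derive_partial_t (R : realType) (phi : R * R -> R) (t x : R) :
  derivable phi (t, x) (1, 0) ->
  is_derive t 1 (fun s : R => phi (s, x)) ('D_(1, 0) phi (t, x)).
Proof.
have E : (fun h : R => h^-1 *: (((fun s => phi (s, x)) \o shift t) (h *: (1 : R)) - phi (t, x)))
   = (fun h : R => h^-1 *: ((phi \o shift (t, x)) (h *: ((1, 0) : R * R)) - phi (t, x))).
  apply/funext => h; rewrite /=; congr (_ *: (phi _ - _)).
  by congr (_, _); rewrite /= scaler0 add0r.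
by move=> d; split; rewrite /derivable /derive E.
Qed.

Lemma is_derive_partial_x (R : realType) (phi : R * R -> R) (t x : R) :
  derivable phi (t, x) (0, 1) ->
  is_derive x 1 (fun y : R => phi (t, y)) ('D_(0, 1) phi (t, x)).
Proof.
have E : (fun h : R => h^-1 *: (((fun y => phi (t, y)) \o shift x) (h *: (1 : R)) - phi (t, x)))
   = (fun h : R => h^-1 *: ((phi \o shift (t, x)) (h *: ((0, 1) : R * R)) - phi (t, x))).
  apply/funext => h; rewrite /=; congr (_ *: (phi _ - _)).
  by congr (_, _); rewrite /= scaler0 add0r.
by move=> d; split; rewrite /derivable /derive E.
Qed.

Lemma doubly_periodic_derive (R : realType) (phi : R * R -> R) (v : R * R) :
  doubly_periodic phi -> doubly_periodic ('D_v phi).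
Proof.
move=> per t x.
have perE (c : R * R) : (forall y, phi (y + c) = phi y) ->
    'D_v phi ((t, x) + c) = 'D_v phi (t, x).
  move=> phic; rewrite /derive.
  rewrite (_ : (fun h => _) = (fun h : R => h^-1 *: ((phi \o shift (t, x)) (h *: v) - phi (t, x))))//.
  by apply/funext => h /=; rewrite addrA !phic.
split.
- have := perE (2 * pi, 0); rewrite /= => <-; last first.
    by move=> [s y]; rewrite -(per s y).1; congr (phi (_, _)); rewrite /= addr0.
  by congr ('D_v phi (_, _)); rewrite /= addr0.
- have := perE (0, 2 * pi); rewrite /= => <-; last first.
    by move=> [s y]; rewrite -(per s y).2; congr (phi (_, _)); rewrite /= addr0.
  by congr ('D_v phi (_, _)); rewrite /= addr0.
Qed.

(** The wave operator tested against the stationary function [V] differs from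
    the nonlinear term by a total derivative in each variable: pointwise,
    [V (phi_tt - phi_xx) - f(V) phi = (V phi_t)_t - (V phi_x - V' phi)_x]
    because [V'' = - f(V)].  Both total derivatives come from doubly periodic
    functions, so they integrate to zero over the square. *)
Lemma stationary_weak_solution (R : realType) (p : R) (V W : R -> R) :
  1 < p ->
  (forall x : R, is_derive x 1 V (W x)) ->
  (forall x : R, is_derive x 1 W (- power_nonlinearity p (V x))) ->
  (forall x, V (x + 2 * pi) = V x /\ W (x + 2 * pi) = W x) ->
  weak_solution p (fun z : R * R => V z.2).
Proof.
move=> p1 dV dW per.
have comp2 (f : R -> R) : continuous f -> continuous (fun z : R * R => f z.2).
  move=> fc z; apply: (@continuous_comp _ _ _ (fun z : R * R => z.2) f); last exact: fc.
  exact: cvg_snd.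
have Vc : continuous V by move=> x; exact: is_derive_continuous.
have uc := comp2 _ Vc.
have fuc : continuous (fun z : R * R => power_nonlinearity p (V z.2)).
  apply: (comp2 (fun x => power_nonlinearity p (V x))) => x.
  apply: (@continuous_comp _ _ _ V); first exact: Vc.
  exact: continuous_power_nonlinearity.
split.
- exact: continuous_measurable_plane.
- by move=> t x; split => //=; rewrite (per x).1.
- apply: (continuous_integrable_square _ (fun z => `|V z.2| `^ (p + 1))).
  apply: (comp2 (fun x => `|V x| `^ (p + 1))) => x.
  apply: (@continuous_comp _ _ _ V (fun s => `|s| `^ (p + 1))); first exact: Vc.
  by apply: continuous_powR_norm; lra.
- move=> phi sphi pphi.
  have [phic dphi] := sphi [::].
  have [phitc dphit] := sphi [:: (1, 0)].
  have [phixc dphix] := sphi [:: (0, 1)].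
  have [phittc _] := sphi [:: (1, 0); (1, 0)].
  have [phixxc _] := sphi [:: (0, 1); (0, 1)].
  rewrite /= in phic dphi phitc dphit phixc dphix phittc phixxc.
  have pphit := doubly_periodic_derive _ _ (1, 0) pphi.
  have pphix := doubly_periodic_derive _ _ (0, 1) pphi.
  set D1 := 'D_(1, 0) phi in phitc dphit phittc pphit *.
  set D2 := 'D_(0, 1) phi in phixc dphix phixxc pphix *.
  (* I1 and I2 are the two total derivatives; the nonlinear term I3 enters I2
     through the differential equation for V. *)
  pose I1 z := V z.2 * 'D_(1, 0) D1 z.
  pose I3 z := power_nonlinearity p (V z.2) * phi z.
  pose I2 z := V z.2 * 'D_(0, 1) D2 z + I3 z.
  have I1c : continuous I1 by move=> z; apply: cvgM; [exact: uc|exact: phittc].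
  have I3c : continuous I3 by move=> z; apply: cvgM; [exact: fuc|exact: phic].
  have I2c : continuous I2.
    by move=> z; apply: cvgD; [apply: cvgM; [exact: uc|exact: phixxc]|exact: I3c].
  have I12c : continuous (fun z => I1 z - I2 z).
    by move=> z; apply: cvgB; [exact: I1c|exact: I2c].
  have int1 : \int[leb2 R]_(z in @period_square R) I1 z = 0.
    apply: (integral_square_dt _ _ (fun z => V z.2 * D1 z)) => //.
    - move=> t x.
      exact: (is_derive_scale _ _ (V x) _ _ (is_derive_partial_t _ _ _ _ (dphit (t, x) (1, 0)))).
    - by move=> t x; rewrite (pphit t x).1.
  have int2 : \int[leb2 R]_(z in @period_square R) I2 z = 0.
    apply: (integral_square_dx _ _ (fun z => V z.2 * D2 z - W z.2 * phi z)) => //.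
    - move=> t x.
      have d1 := is_derive_mul _ _ _ _ _ _ (dV x) (is_derive_partial_x _ _ _ _ (dphix (t, x) (0, 1))).
      have d2 := is_derive_mul _ _ _ _ _ _ (dW x) (is_derive_partial_x _ _ _ _ (dphi (t, x) (0, 1))).
      have := is_deriveB d1 d2; move/is_derive_eq; apply.
      by rewrite /I2 /I3 /D2 /=; ring.
    - by move=> t x; rewrite /= (pphix t x).2 (pphi t x).2 (per x).1 (per x).2.
  have mS : measurable (@period_square R : set (measurableTypeR R * measurableTypeR R)).
    exact: measurableX.
  transitivity (\int[leb2 R]_(z in @period_square R) ((I1 z - I2 z) + I3 z)).
    apply: eq_Rintegral => z _; rewrite /I1 /I2 opprD addrA subrK.
    have -> : wave_op phi z = 'D_(1, 0) D1 z - 'D_(0, 1) D2 z by [].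
    by rewrite mulrBr.
  rewrite RintegralD//; [|exact: continuous_integrable_square..].
  rewrite RintegralB//; [|exact: continuous_integrable_square..].
  by rewrite int1 int2 subrr add0r.
Qed.

(** Two continuous functions that differ at a point differ on a nonempty open
    rectangle, which has positive area. *)
Lemma continuous_not_ae_eq (R : realType) (f g : R * R -> R) (z : R * R) :
  continuous f -> continuous g -> f z != g z ->
  ~ {ae leb2 R, forall y : R * R, f y = g y}.
Proof.
case: z => t x fc gc fg [N [mN N0 fgN]].
have : nbhs (t, x) [set y | f y - g y != 0].
  have fgc : (f y - g y) @[y --> (t, x)] --> f (t, x) - g (t, x).
    by apply: cvgB; [exact: fc|exact: gc].
  apply: (cvgr_neq0 _ fgc).
  by rewrite subr_eq0.
move=> /nbhs_ballP[e /= e0 ball_sub].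
have sub : ball t e `*` ball x e `<=` N.
  move=> [s y] [/= ts xy]; apply: fgN => /= fgsy.
  have /= := ball_sub (s, y) (conj ts xy).
  by rewrite fgsy subrr eqxx.
have mB (a : R) : measurable (ball a e : set (measurableTypeR R)).
  exact: measurable_ball.
have : (leb2 R (ball t e `*` ball x e) <= leb2 R N)%E.
  apply: le_measure => //; rewrite inE//; exact: measurableX.
rewrite N0 leb2_rectangle// !lebesgue_measure_ball ?(ltW e0)// -EFinM lee_fin.
by rewrite leNgt mulr_gt0// mulrn_wgt0.
Qed.

Theorem mainTheorem11 (R : realType) (p : R) (hp : 1 < p) :
  exists u : nat -> R * R -> R,
    (forall n : nat, weak_solution p (u n)) /\
    (forall m n : nat, m <> n ->
       ~ {ae leb2 R, forall z : R * R, u m z = u n z}).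
Proof.
have [V [W [a [ainj VW]]]] := periodic_profiles _ _ hp.
exists (fun n z => V n z.2); split.
  by move=> n; have [dV dW per _] := VW n; exact: stationary_weak_solution dW per.
have uc n : continuous (fun z : R * R => V n z.2).
  have [dV _ _ _] := VW n.
  move=> z; apply: (@continuous_comp _ _ _ (fun z : R * R => z.2) (V n)).
    exact: cvg_snd.
  exact: is_derive_continuous.
have differ m n : a m < a n -> exists x, V n x != V m x.
  move=> amn; have [_ _ _ [_ [x Vx]]] := VW n; have [_ _ _ [Vm _]] := VW m.
  by exists x; rewrite gt_eqF// Vx (le_lt_trans (Vm x)).
move=> m n mn.
have [x neq] : exists x, V m x != V n x.
  case: (ltgtP (a m) (a n)) => [/differ[x]|/differ[x]|/ainj//]; exists x => //.
  by rewrite eq_sym.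
exact: (continuous_not_ae_eq _ _ _ (0, x) (uc m) (uc n) neq).
Qed.
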